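(* Let $L\subset\mathbb R^2$ be the standard tropical line. The set $$\mathcal S = \left\{ \left( \overline{0 \oplus x^u y^v},\ f_{\Delta(\{ (0,0), (u,v) \})} \right) \ \middle|\ u,v\in\mathbb Z,\ \gcd(u,v)=1,\ \text{and } \big(u>0 \text{ or } (u,v)=(0,1)\big) \right\}$$ is a minimal generating set of the congruence $\mathbf E(L)$ on $\mathbb T[x^{\pm},y^{\pm}]_{\mathrm{fcn}}$; that is, $\mathcal S$ generates $\mathbf E(L)$ and no proper subset of $\mathcal S$ generates $\mathbf E(L)$.
   Context: The tropical semifield is $\mathbb T=\mathbb R\cup\{-\infty\}$ with addition $a\oplus b=\max\{a,b\}$ and multiplication $a\odot b=a+b$ (additive identity $-\infty$, multiplicative identity $0$). A tropical Laurent polynomial $P=\bigoplus_{(u,v)\in\mathbb Z^2}a_{(u,v)}x^uy^v$ ($a_{(u,v)}\in\mathbb T$, all but finitely many equal to $-\infty$) defines the function $\overline P:\mathbb R^2\to\mathbb T$, $\overline P(p,q)=\max_{(u,v)}(a_{(u,v)}+up+vq)$. $\mathbb T[x^{\pm},y^{\pm}]_{\mathrm{fcn}}$ is the semiring of all such functions under pointwise $\oplus,\odot$. A congruence on a commutative semiring $R$ is an equivalence relation $E\subset R\times R$ closed under coordinatewise addition and multiplication; a subset of $R\times R$ generates $E$ if $E$ is the smallest congruence containing it. The standard tropical line $L$ has support $|L|=\rho_1\cup\rho_2\cup\rho_3$, where $\rho_1=\mathbb R_{\ge0}(-1,0)$, $\rho_2=\mathbb R_{\ge0}(0,-1)$,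 $\rho_3=\mathbb R_{\ge0}(1,1)$. $\mathbf E(L)=\mathbf E(|L|)=\{(f,g): f,g\in\mathbb T[x^{\pm},y^{\pm}]_{\mathrm{fcn}},\ f=g\text{ on }|L|\}$. For a nonempty finite set $A=\{(x_1,y_1),\ldots,(x_k,y_k)\}\subset\mathbb Z^2$, put $a=\min_i x_i$, $b=\min_i y_i$, $c=\max_i(x_i+y_i)$ and $\Delta(A)=\{(x,y)\in\mathbb Z^2 : x\ge a,\ y\ge b,\ x+y\le c\}$ (a finite set). For a finite set $A\subset\mathbb Z^2$, $f_A=\overline{\bigoplus_{(u,v)\in A}x^uy^v}$ (all coefficients equal to $0\in\mathbb T$). *)

(* Defs.v *)
From HB Require Import structures.
From mathcomp Require Import all_boot all_order all_algebra finmap.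
From mathcomp Require Import mathcomp_extra boolp classical_sets functions.
From mathcomp Require Import cardinality reals zify.

Set Implicit Arguments.
Unset Strict Implicit.
Unset Printing Implicit Defensive.
Import Order.TTheory GRing.Theory Num.Theory.
Local Open Scope classical_set_scope.
Local Open Scope ring_scope.

(* [None] is -oo.  Under the instances below, the ring operations of [trop R]
   are the tropical ones: 0 is -oo, 1 is the real number 0, + is max and * is
   the addition of real numbers. *)
Definition trop (R : realType) : Type := option R.

HB.instance Definition _ (R : realType) := Choice.on (trop R).

Definition tfin (R : realType) (r : R) : trop R := Some r.

Section TropicalSemifield.
Variable R : realType.
Implicit Types a b c : trop R.

Definition tadd a b : trop R :=
  match a, b with
  | None, _ => b
  | _, None => a
  | Some r, Some s => tfin (Num.max r s)
  end.

Definition tmul a b : trop R :=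
  match a, b with
  | Some r, Some s => tfin (r + s)
  | _, _ => None
  end.

Let taddA : associative tadd.
Proof. by move=> [a|] [b|] [c|] //=; rewrite maxA. Qed.

Let taddC : commutative tadd.
Proof. by move=> [a|] [b|] //=; rewrite maxC. Qed.

Let tadd0 : left_id (None : trop R) tadd.
Proof. by case. Qed.

HB.instance Definition _ := GRing.isNmodule.Build (trop R) taddA taddC tadd0.

Let tmulA : associative tmul.
Proof. by move=> [a|] [b|] [c|] //=; rewrite addrA. Qed.

Let tmulC : commutative tmul.
Proof. by move=> [a|] [b|] //=; rewrite addrC. Qed.

Let tmul1 : left_id (tfin 0) tmul.
Proof. by move=> [a|] //=; rewrite add0r. Qed.

Let tmulDl : left_distributive tmul tadd.
Proof. by move=> [a|] [b|] [c|] //=; rewrite addr_maxl. Qed.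

Let tmul0 : left_zero (0 : trop R) tmul.
Proof. by []. Qed.

HB.instance Definition _ := GRing.Nmodule_isComPzSemiRing.Build (trop R)
  tmulA tmulC tmul1 tmulDl tmul0.

Lemma tfinD (r s : R) : tfin r + tfin s = tfin (Num.max r s).
Proof. by []. Qed.

Lemma tfinM (r s : R) : tfin r * tfin s = tfin (r + s).
Proof. by []. Qed.

End TropicalSemifield.

(* A tropical Laurent polynomial, as its family of coefficients indexed by the
   exponents (u, v); the default coefficient 0 is -oo. *)
Definition tlpoly (R : realType) := {fsfun int * int -> trop R with 0}.

Definition tmonom (R : realType) (m : int * int) (z : R * R) : trop R :=
  tfin (z.1 *~ m.1 + z.2 *~ m.2).

Definition tleval (R : realType) (P : tlpoly R) (z : R * R) : trop R :=
  \sum_(m <- finsupp P) P m * tmonom m z.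

Definition is_tlfun (R : realType) (f : R * R -> trop R) : Prop :=
  exists P : tlpoly R, f = tleval P.

(* Functions, not polynomials: distinct elements of [tlpoly R] may define the
   same element of [tlfun R]. *)
Record tlfun (R : realType) := TLFun {
  tlfun_val :> R * R -> trop R;
  _ : `[< is_tlfun tlfun_val >] }.

HB.instance Definition _ (R : realType) := [isSub for @tlfun_val R].
HB.instance Definition _ (R : realType) := [Choice of tlfun R by <:].

Section TropicalFunctions.
Variable R : realType.
Implicit Types (f g h : tlfun R) (P : tlpoly R) (z : R * R).

Lemma tlfunP f g : f =1 g -> f = g.
Proof. by move=> fg; apply/val_inj/funext. Qed.

Lemma tlevalE P (K : {fset int * int}) z : (finsupp P `<=` K)%fset ->
  tleval P z = \sum_(m <- K) P m * tmonom m z.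
Proof.
move=> PK; rewrite /tleval (big_fset_incl _ PK) // => m _ mP.
by rewrite fsfun_dflt // mul0r.
Qed.

Lemma is_tlfun_sum (s : seq (trop R * (int * int))) :
  is_tlfun (fun z => \sum_(t <- s) t.1 * tmonom t.2 z).
Proof.
pose K := [fset t.2 | t in s]%fset.
pose P : tlpoly R :=
  [fsfun m in K => \sum_(t <- s | t.2 == m) t.1 | 0].
exists P; apply/funext => z.
have PK : (finsupp P `<=` K)%fset by apply: finsupp_sub.
rewrite (tlevalE _ PK).
transitivity (\sum_(m <- K) \sum_(t <- s | t.2 == m) t.1 * tmonom t.2 z).
  rewrite (exchange_big_dep predT) //= big_seq [RHS]big_seq.
  apply: eq_bigr => t ts.
  rewrite big_mkcond (bigD1_seq t.2) ?fset_uniq //=; last first.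
    by apply/imfsetP; exists t.
  by rewrite eqxx big1 ?addr0 // => i /negPf; rewrite eq_sym => ->.
rewrite big_seq [RHS]big_seq; apply: eq_bigr => m mK.
by rewrite fsfunE mK mulr_suml; apply: eq_bigr => t /eqP ->.
Qed.

Lemma tlevalP f : exists P, f =1 tleval P.
Proof. by case: f => f /= /asboolP[P ->]; exists P. Qed.

Lemma is_tlfun0 : is_tlfun (fun=> 0 : trop R).
Proof.
by have := is_tlfun_sum [::]; under eq_fun do rewrite big_nil.
Qed.

Lemma is_tlfun1 : is_tlfun (fun=> 1 : trop R).
Proof.
have := is_tlfun_sum [:: (1, (0, 0))].
under eq_fun => z do rewrite big_seq1 /tmonom /= !mulr0z addr0 mul1r.
by [].
Qed.

Lemma is_tlfunD f g : is_tlfun (fun z => f z + g z).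
Proof.
have [P fP] := tlevalP f; have [Q gQ] := tlevalP g.
have := is_tlfun_sum ([seq (P m, m) | m <- finsupp P] ++
                      [seq (Q m, m) | m <- finsupp Q]).
under eq_fun => z do rewrite big_cat !big_map /=.
by under [X in _ -> is_tlfun X]eq_fun => z do rewrite fP gQ.
Qed.

Lemma tmonomD (m n : int * int) z :
  tmonom (m + n) z = tmonom m z * tmonom n z.
Proof. by rewrite /tmonom tfinM /= !mulrzDr addrACA. Qed.

Lemma is_tlfunM f g : is_tlfun (fun z => f z * g z).
Proof.
have [P fP] := tlevalP f; have [Q gQ] := tlevalP g.
have := is_tlfun_sum
  [seq (P m * Q n, m + n) | m <- finsupp P, n <- finsupp Q].
congr is_tlfun; apply/funext => z.
rewrite big_allpairs_dep fP gQ mulr_suml; apply: eq_bigr => m _.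
by rewrite mulr_sumr; apply: eq_bigr => n _; rewrite /= tmonomD mulrACA.
Qed.

Definition tlfun0 : tlfun R := TLFun (asboolT is_tlfun0).
Definition tlfun1 : tlfun R := TLFun (asboolT is_tlfun1).
Definition tlfunD f g : tlfun R := TLFun (asboolT (is_tlfunD f g)).
Definition tlfunM f g : tlfun R := TLFun (asboolT (is_tlfunM f g)).

Let addA : associative tlfunD.
Proof. by move=> f g h; apply: tlfunP => z /=; rewrite addrA. Qed.

Let addC : commutative tlfunD.
Proof. by move=> f g; apply: tlfunP => z /=; rewrite addrC. Qed.

Let add0 : left_id tlfun0 tlfunD.
Proof. by move=> f; apply: tlfunP => z /=; rewrite add0r. Qed.

HB.instance Definition _ := GRing.isNmodule.Build (tlfun R) addA addC add0.

Let mulA : associative tlfunM.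
Proof. by move=> f g h; apply: tlfunP => z /=; rewrite mulrA. Qed.

Let mulC : commutative tlfunM.
Proof. by move=> f g; apply: tlfunP => z /=; rewrite mulrC. Qed.

Let mul1 : left_id tlfun1 tlfunM.
Proof. by move=> f; apply: tlfunP => z /=; rewrite mul1r. Qed.

Let mulDl : left_distributive tlfunM tlfunD.
Proof. by move=> f g h; apply: tlfunP => z /=; rewrite mulrDl. Qed.

Let mul0 : left_zero (0 : tlfun R) tlfunM.
Proof. by move=> f; apply: tlfunP => z /=; rewrite mul0r. Qed.

HB.instance Definition _ := GRing.Nmodule_isComPzSemiRing.Build (tlfun R)
  mulA mulC mul1 mulDl mul0.

Definition tlfun_of (P : tlpoly R) : tlfun R :=
  TLFun (asboolT (ex_intro _ P erefl : is_tlfun (tleval P))).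

(* The coefficient 1 of [trop R] is the real number 0. *)
Definition fset_tlfun (A : {fset int * int}) : tlfun R :=
  tlfun_of [fsfun m in A => 1 | 0].

Lemma fset_tlfunE (A : {fset int * int}) z :
  fset_tlfun A z = \sum_(m <- A) tmonom m z.
Proof.
rewrite /= (@tlevalE _ A) ?finsupp_sub // big_seq [RHS]big_seq.
by apply: eq_bigr => m mA; rewrite fsfunE mA mul1r.
Qed.

End TropicalFunctions.

Section Congruences.
Variable S : comPzSemiRingType.

Record congruence (E : set (S * S)) : Prop := Congruence {
  congruence_refl : forall f, E (f, f);
  congruence_sym : forall f g, E (f, g) -> E (g, f);
  congruence_trans : forall f g h, E (f, g) -> E (g, h) -> E (f, h);
  congruenceD : forall f g f' g',
    E (f, g) -> E (f', g') -> E (f + f', g + g');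
  congruenceM : forall f g f' g',
    E (f, g) -> E (f', g') -> E (f * f', g * g') }.

Definition generates (B E : set (S * S)) : Prop :=
  [/\ congruence E, B `<=` E &
      forall F : set (S * S), congruence F -> B `<=` F -> E `<=` F].

Definition minimal_generating_set (B E : set (S * S)) : Prop :=
  generates B E /\ forall B' : set (S * S), B' `<` B -> ~ generates B' E.

End Congruences.

Definition ray (R : realType) (d : R * R) : set (R * R) :=
  [set (t * d.1, t * d.2) | t in [set t : R | 0 <= t]].

(* The standard tropical line is represented by its support. *)
Definition tropical_line (R : realType) : set (R * R) :=
  ray (-1, 0) `|` ray (0, -1) `|` ray (1, 1).

Definition congruence_of (R : realType) (Z : set (R * R)) :
    set (tlfun R * tlfun R) :=
  [set fg : tlfun R * tlfun R | forall z, Z z -> fg.1 z = fg.2 z].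

(* The default value [head 0 s] is immaterial unless s is empty. *)
Definition seq_min (s : seq int) : int := \big[Num.min/head 0 s]_(i <- s) i.
Definition seq_max (s : seq int) : int := \big[Num.max/head 0 s]_(i <- s) i.

Definition Delta_set (A : {fset int * int}) : set (int * int) :=
  let a := seq_min [seq m.1 | m <- A] in
  let b := seq_min [seq m.2 | m <- A] in
  let c := seq_max [seq m.1 + m.2 | m <- A] in
  [set m | [/\ a <= m.1, b <= m.2 & m.1 + m.2 <= c]].

(* [fset_set] is the identity on finite sets, see [in_Delta]. *)
Definition Delta (A : {fset int * int}) : {fset int * int} :=
  fset_set (Delta_set A).

Lemma finite_Delta_set A : finite_set (Delta_set A).
Proof.
rewrite /Delta_set /=.
set a := seq_min _; set b := seq_min _; set c := seq_max _.
pose n := absz (c - a - b)%R.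
pose K := [fset ((a + i%:Z)%R, (b + j%:Z)%R) |
  i in iota 0 n.+1, j in iota 0 n.+1]%fset.
apply: sub_finite_set (finite_fset K) => -[x y] /= [ax yb xyc].
apply/imfset2P; exists (absz (x - a)%R).
  by rewrite /= inE mem_iota /n; lia.
exists (absz (y - b)%R); first by rewrite /= inE mem_iota /n; lia.
by congr pair; lia.
Qed.

Lemma in_Delta A m : (m \in Delta A) = (m \in Delta_set A).
Proof. exact/in_fset_set/finite_Delta_set. Qed.

(* As (u, v) != (0, 0), the polynomial 0 (+) x^u y^v is the one with all its
   coefficients equal to 0 in R on the exponents (0, 0) and (u, v). *)
Definition line_generators (R : realType) : set (tlfun R * tlfun R) :=
  [set fg | exists u v : int,
    [/\ gcdz u v = 1, 0 < u \/ (u, v) = (0, 1) &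
        fg = (fset_tlfun R [fset (0, 0); (u, v)]%fset,
              fset_tlfun R (Delta [fset (0, 0); (u, v)]%fset))]].

Arguments line_generators R : clear implicits.
Arguments tropical_line R : clear implicits.

(* Main.v *)
(* Modulo a congruence containing the generators, tropical functions form an
   idempotent semiring, ordered by f <= g iff g = g + f.  Its order contains the
   pointwise order, and multiples and translates of the generators give
   x^n <= x^p + x^q for n in Delta({p, q}); the vertices of the triangle
   suffice, since a linear form on a cone of the fan of L attains its maximum over the
   triangle at a vertex.
   Let f = max_m (a_m + m.z), let p be an exponent whose coefficient is maximal,
   and assume c x^n <= f on L.  As a_m <= a_p, the relation above dominates
   a_m x^k by f for every k in Delta({p, m}).  For each ray, this and the
   inequality on that ray alone show that f dominates c x^k, where k has the
   slope max(n, p) along this ray and at most that of p along the two others.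
   The exponent n lies in Delta of two of these three exponents k, so f
   dominates c x^n.  Hence functions that agree on L are congruent.
   For minimality, let w be orthogonal to (u, v).  The functions whose Newton
   polygon has positive width along w are stable under the addition of any
   function and under the multiplication by any nonzero one, so identifying
   them when they agree on L, and leaving the other functions alone, is a
   congruence.  It contains every generator but the one indexed by (u, v). *)
Require Import Defs.
From mathcomp Require Import all_boot all_order all_algebra finmap.
From mathcomp Require Import boolp classical_sets reals.
From mathcomp Require Import zify ring lra.

Set Implicit Arguments.
Unset Strict Implicit.
Unset Printing Implicit Defensive.
Import Order.TTheory GRing.Theory Num.Theory.
Local Open Scope classical_set_scope.
Local Open Scope ring_scope.

(** * Membership in the triangle of two exponents *)

Lemma seq_min_mem s : s != [::] -> seq_min s \in s.
Proof.
case: s => // x s _; rewrite /seq_min /= big_cons.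
suff : Num.min x (\big[Num.min/x]_(i <- s) i) \in x :: s by [].
elim: s => [|y s]; first by rewrite big_nil minxx mem_head.
rewrite big_cons minCA !inE; case: (leP y) => _; first by rewrite eqxx orbT.
by case/orP=> ->; rewrite ?orbT.
Qed.

Lemma seq_min_le s x : x \in s -> seq_min s <= x.
Proof.
rewrite /seq_min; elim: s (head 0 s) => // y s IH d.
by rewrite big_cons inE ge_min => /predU1P[->|/IH->]; rewrite ?lexx ?orbT.
Qed.

Lemma seq_max_mem s : s != [::] -> seq_max s \in s.
Proof.
case: s => // x s _; rewrite /seq_max /= big_cons.
suff : Num.max x (\big[Num.max/x]_(i <- s) i) \in x :: s by [].
elim: s => [|y s]; first by rewrite big_nil maxxx mem_head.
rewrite big_cons maxCA !inE; case: (leP y) => _; last by rewrite eqxx orbT.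
by case/orP=> ->; rewrite ?orbT.
Qed.

Lemma le_seq_max s x : x \in s -> x <= seq_max s.
Proof.
rewrite /seq_max; elim: s (head 0 s) => // y s IH d.
by rewrite big_cons inE le_max => /predU1P[->|/IH->]; rewrite ?lexx ?orbT.
Qed.

Lemma fset2_nil (T : choiceType) (a b : T) : ([fset a; b]%fset : seq T) != [::].
Proof.
by apply/eqP => /(congr1 (fun s => a \in s)); rewrite inE /= !inE eqxx.
Qed.

(** A minimum lies below a bound iff one of its arguments does, and dually for a maximum; this
    disjunctive form lets [lia] decide membership. *)
Lemma in_Delta2 (p q n : int * int) :
  (n \in Delta [fset p; q]%fset) =
  [&& (p.1 <= n.1) || (q.1 <= n.1), (p.2 <= n.2) || (q.2 <= n.2) &
      (n.1 + n.2 <= p.1 + p.2) || (n.1 + n.2 <= q.1 + q.2)].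
Proof.
have mem (g : int * int -> int) x :
    x \in [seq g m | m <- [fset p; q]%fset] -> x = g p \/ x = g q.
  by case/mapP => m; rewrite !inE => /orP[] /eqP -> ->; [left|right].
have memp (g : int * int -> int) : g p \in [seq g m | m <- [fset p; q]%fset].
  by apply: map_f; rewrite !inE eqxx.
have memq (g : int * int -> int) : g q \in [seq g m | m <- [fset p; q]%fset].
  by apply: map_f; rewrite !inE eqxx orbT.
have nil (g : int * int -> int) : [seq g m | m <- [fset p; q]%fset] != [::].
  by rewrite -size_eq0 size_map size_eq0 fset2_nil.
rewrite in_Delta; apply/idP/and3P => [/set_mem[h1 h2 h3]|[h1 h2 h3]].
  split.
  - by case/mem: (seq_min_mem (nil (fun m => m.1))) h1 => -> ->; rewrite ?orbT.
  - by case/mem: (seq_min_mem (nil (fun m => m.2))) h2 => -> ->; rewrite ?orbT.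
  - by case/mem: (seq_max_mem (nil (fun m => m.1 + m.2))) h3 => -> ->;
      rewrite ?orbT.
apply/mem_set; split.
- by case/orP: h1; apply: le_trans; apply: seq_min_le;
    [exact: memp|exact: memq].
- by case/orP: h2; apply: le_trans; apply: seq_min_le;
    [exact: memp|exact: memq].
- by case/orP: h3 => /le_trans; apply; apply: le_seq_max;
    [exact: (memp (fun m => m.1 + m.2))|exact: (memq (fun m => m.1 + m.2))].
Qed.

(** * Multiples and primitive integer vectors *)

Lemma pairX (a b : int) k : (a, b) *+ k = (a *+ k, b *+ k).
Proof. by elim: k => // k IH; rewrite !mulrS IH. Qed.

Lemma min0X (a : int) k : Num.min 0 (a *+ k) = Num.min 0 a *+ k.
Proof.
by rewrite -[a *+ k]mulr_natr -[RHS]mulr_natr !natz minr_pMl // mul0r.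
Qed.

Lemma max0X (a : int) k : Num.max 0 (a *+ k) = Num.max 0 a *+ k.
Proof.
by rewrite -[a *+ k]mulr_natr -[RHS]mulr_natr !natz maxr_pMl // mul0r.
Qed.

Lemma primitive_decomposition m : m != (0, 0) ->
  exists (k : nat) m', gcdz m'.1 m'.2 = 1 /\ m = m' *+ k.
Proof.
case: m => u v uv0; have gE : (`|gcdz u v|%N : int) = gcdz u v by [].
have g0 : gcdz u v != 0.
  by rewrite gcdz_eq0; apply: contra uv0 => /andP[/eqP-> /eqP->].
have [gu gv] : (gcdz u v %| u)%Z /\ (gcdz u v %| v)%Z.
  by rewrite dvdz_gcdl dvdz_gcdr.
exists `|gcdz u v|%N, (divz u (gcdz u v), divz v (gcdz u v)); split=> /=.
  apply: (mulfI g0); rewrite mulr1 -[X in X * _]gE mulz_gcdr.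
  by rewrite ![gcdz u v * _]mulrC !divzK.
have XE (a : int) : a *+ `|gcdz u v|%N = a * gcdz u v.
  by rewrite -mulr_natr natz.
by rewrite pairX !XE !divzK.
Qed.

(** If both first coordinates are positive, each divides the other by Gauss's lemma; the mixed cases
    contradict proportionality. *)
Lemma proportional_eq u v u' v' : gcdz u v = 1 -> 0 < u \/ (u, v) = (0, 1) ->
  gcdz u' v' = 1 -> 0 < u' \/ (u', v') = (0, 1) -> u * v' = v * u' ->
  (u, v) = (u', v').
Proof.
move=> c n c' n' e; case: n n' => [u0|[uE vE]] [u0'|[uE' vE']].
- have uu' : (u %| u')%Z.
    by rewrite -(@Gauss_dvdzr u v) ?/coprimez ?c // -e dvdz_mulr.
  have u'u : (u' %| u)%Z.
    by rewrite -(@Gauss_dvdzr u' v') ?/coprimez ?c' // mulrC e dvdz_mull.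
  have uE : `|u|%N = `|u'|%N by apply/eqP; rewrite eqn_dvd; apply/andP.
  have {}uE : u = u' by lia.
  by subst u'; congr pair; nia.
- nia.
- nia.
- by subst.
Qed.

(** * Tropical arithmetic and decomposition into monomials *)

Section Trop.
Variable R : realType.
Implicit Types (x y : trop R) (r : R) (f g h : tlfun R) (m n p q : int * int)
  (z : R * R) (t : R * (int * int)).

Lemma troppxx x : x + x = x.
Proof. by case: x => // r; rewrite tfinD maxxx. Qed.

Lemma tlfunxx f : f + f = f.
Proof. by apply: tlfunP => z; apply: troppxx. Qed.

Lemma tfin_le (r r' : R) : (tfin r + tfin r' = tfin r') <-> r <= r'.
Proof.
rewrite tfinD; split; first by case=> <-; rewrite le_max lexx.
by move=> rr'; rewrite max_r.
Qed.

Lemma tlfunDE f g z : (f + g) z = f z + g z.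
Proof. by []. Qed.

Lemma tlfunME f g z : (f * g) z = f z * g z.
Proof. by []. Qed.

Lemma tlfunXE f k z : (f ^+ k) z = f z ^+ k.
Proof. by elim: k => // k IH; rewrite !exprS tlfunME IH. Qed.

Lemma tfinX (r : R) k : tfin r ^+ k = tfin (r *+ k).
Proof. by elim: k => // k IH; rewrite exprS IH tfinM mulrS. Qed.

Lemma trop_anti x y : x + y = y -> y + x = x -> x = y.
Proof. by move=> <-; rewrite addrC addrA troppxx. Qed.

Definition dot n z : R := n.1%:~R * z.1 + n.2%:~R * z.2.

Lemma tmonomE n z : tmonom n z = tfin (dot n z).
Proof. by rewrite /tmonom /dot !mulrzl. Qed.

Lemma dot0 z : dot (0, 0) z = 0.
Proof. by rewrite /dot /= !mul0r addr0. Qed.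

Lemma dotD m n z : dot (m + n) z = dot m z + dot n z.
Proof. by rewrite /dot /= !intrD; ring. Qed.

Lemma dotX m k z : dot (m *+ k) z = dot m z *+ k.
Proof.
by elim: k => [|k IH]; rewrite ?dot0 // !mulrS dotD IH.
Qed.

Lemma dotZ n (x : R) z : dot n (x * z.1, x * z.2) = x * dot n z.
Proof. by rewrite /dot /=; ring. Qed.

(** The coefficient is a real number, so a monomial never takes the value -oo. *)
Definition mono t : tlfun R :=
  tlfun_of [fsfun m in [fset t.2]%fset => tfin t.1 | 0].

Lemma monoE t z : mono t z = tfin (t.1 + dot t.2 z).
Proof.
rewrite /= (@tlevalE _ _ [fset t.2]%fset) ?finsupp_sub //.
by rewrite big_seq_fset1 fsfunE inE eqxx tmonomE tfinM.
Qed.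

Lemma monoM t t' : mono t * mono t' = mono (t.1 + t'.1, t.2 + t'.2).
Proof.
apply: tlfunP => z; rewrite tlfunME !monoE tfinM.
by congr tfin; rewrite /dot /= !intrD; ring.
Qed.

Lemma mono2E p q z :
  (mono (0, p) + mono (0, q)) z = tfin (Num.max (dot p z) (dot q z)).
Proof. by rewrite tlfunDE !monoE !add0r tfinD. Qed.

Lemma sumE (I : Type) (s : seq I) (F : I -> tlfun R) z :
  (\sum_(i <- s) F i) z = \sum_(i <- s) F i z.
Proof. exact: (big_morph (fun f : tlfun R => f z)). Qed.

Lemma tlfun_terms f : exists s, f = \sum_(t <- s) mono t.
Proof.
have [P fP] := tlevalP f.
exists [seq (odflt 0 (P m : option R), m) | m <- finsupp P].
apply: tlfunP => z; rewrite fP sumE big_map /tleval big_seq [RHS]big_seq.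
apply: eq_bigr => m; rewrite mem_finsupp monoE tmonomE /=.
by case: (P m) => // a _; rewrite tfinM.
Qed.

Lemma fset_tlfun_terms (A : {fset int * int}) :
  fset_tlfun R A = \sum_(m <- A) mono (0, m).
Proof.
apply: tlfunP => z; rewrite fset_tlfunE sumE; apply: eq_bigr => m _.
by rewrite monoE tmonomE add0r.
Qed.

Lemma sum_ge (I : eqType) (s : seq I) (F : I -> trop R) i :
  i \in s -> F i + \sum_(j <- s) F j = \sum_(j <- s) F j.
Proof. by move=> si; rewrite (big_rem i si) /= addrA troppxx. Qed.

Lemma sum_le (I : eqType) (s : seq I) (F : I -> trop R) x :
  (forall i, i \in s -> F i + x = x) -> \sum_(j <- s) F j + x = x.
Proof.
move=> H; rewrite big_seq.
elim/big_rec: _ => [|i y si IH]; first by rewrite add0r.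
by rewrite -addrA IH H.
Qed.

Lemma sum_attained (I : eqType) (s : seq I) (F : I -> R) r :
  tfin r + \sum_(i <- s) tfin (F i) = \sum_(i <- s) tfin (F i) ->
  exists2 i, i \in s & r <= F i.
Proof.
suff [->|[i si ->]] : s = [::] \/
    exists2 i, i \in s & \sum_(i <- s) tfin (F i) = tfin (F i).
- by rewrite big_nil.
- by move/tfin_le; exists i.
elim: s => [|i s IH]; [by left|right].
rewrite big_cons; case: IH => [->|[j sj ->]].
  by exists i; rewrite ?mem_head ?big_nil ?addr0.
rewrite tfinD; have [ji|ij] := leP (F i) (F j).
  by exists j => //; rewrite inE sj orbT.
by exists i; rewrite ?mem_head.
Qed.

Lemma mono_sum_ge (s : seq (R * (int * int))) t z : t \in s ->
  mono t z + (\sum_(t <- s) mono t) z = (\sum_(t <- s) mono t) z.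
Proof.
by move=> ts; rewrite sumE; apply: (@sum_ge _ s (fun t => mono t z)).
Qed.

Lemma fset_tlfun_ge (A : {fset int * int}) m z : m \in A ->
  mono (0, m) z + fset_tlfun R A z = fset_tlfun R A z.
Proof.
move=> mA; rewrite fset_tlfun_terms sumE.
exact: (@sum_ge _ A (fun m => mono (0, m) z)).
Qed.

Lemma mono_attained (s : seq (R * (int * int))) t z :
  mono t z + (\sum_(t <- s) mono t) z = (\sum_(t <- s) mono t) z ->
  exists2 t', t' \in s & t.1 + dot t.2 z <= t'.1 + dot t'.2 z.
Proof.
rewrite sumE monoE.
under eq_bigr do rewrite monoE.
by move/sum_attained.
Qed.

Lemma fset_tlfun2 p q :
  fset_tlfun R [fset p; q]%fset = mono (0, p) + mono (0, q).
Proof.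
apply: tlfunP => z; rewrite tlfunDE; apply: trop_anti; last first.
  by rewrite -addrA !fset_tlfun_ge // !inE eqxx ?orbT.
rewrite fset_tlfun_terms sumE; apply: sum_le => m.
rewrite !inE => /orP[] /eqP ->.
  by rewrite addrA troppxx.
by rewrite addrC -addrA troppxx.
Qed.

(** * Calculus of the order modulo a congruence *)

Section Dominated.
Variable C : set (tlfun R * tlfun R).
Hypothesis HC : congruence C.

(* The order f <= g of the idempotent semiring of functions modulo [C]. *)
Definition dominated f g := C (g, g + f).

Lemma dominated_le f g : (forall z, f z + g z = g z) -> dominated f g.
Proof.
move=> fg; rewrite /dominated; suff -> : g + f = g by apply: congruence_refl.
by apply: tlfunP => z; rewrite tlfunDE addrC fg.
Qed.

(** Modulo [C], the chain is h ~ h + g ~ h + g + f ~ h + f. *)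
Lemma dominated_trans g f h : dominated f g -> dominated g h -> dominated f h.
Proof.
move=> fg gh.
have h1 : C (h + g, h + (g + f)) :=
   congruenceD HC (congruence_refl HC h) fg.
have h2 : C (h + f, h + g + f) := congruenceD HC gh (congruence_refl HC f).
apply: (congruence_trans HC gh); apply: (congruence_trans HC h1).
by rewrite addrA; apply: congruence_sym.
Qed.

Lemma dominatedD f g h : dominated f h -> dominated g h -> dominated (f + g) h.
Proof.
move=> fh gh; have := congruenceD HC fh gh.
by rewrite /dominated tlfunxx addrACA tlfunxx.
Qed.

(** Modulo [C], [g * g'] equals [(g + f) * (g' + f')], whose expansion has [f * f'] among its
    terms. *)
Lemma dominatedM f g f' g' :
  dominated f g -> dominated f' g' -> dominated (f * f') (g * g').
Proof.
move=> fg fg'.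
have h : dominated (f * f') ((g + f) * (g' + f')).
  by apply: dominated_le => z; rewrite !(tlfunDE, tlfunME) mulrDl !mulrDr;
    rewrite addrC -!addrA troppxx.
have e : C (g * g', (g + f) * (g' + f')) by apply: congruenceM.
apply: (congruence_trans HC e); apply: (congruence_trans HC h).
by apply: congruenceD (congruence_sym HC e) (congruence_refl HC _).
Qed.

Lemma dominatedX f g k : dominated f g -> dominated (f ^+ k) (g ^+ k).
Proof.
move=> fg; elim: k => [|k IH]; first exact: dominated_le (fun=> troppxx _).
by rewrite !exprS; apply: dominatedM.
Qed.

Lemma dominated_shift t f g :
  dominated f g -> dominated (mono t * f) (mono t * g).
Proof. by apply/dominatedM/dominated_le => z; apply: troppxx. Qed.

Lemma dominated_sum (I : eqType) (s : seq I) (F : I -> tlfun R) f :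
  (forall i, i \in s -> dominated (F i) f) -> dominated (\sum_(i <- s) F i) f.
Proof.
move=> H; rewrite big_seq; elim/big_ind: _ => // [|g h].
  by apply: dominated_le => z; rewrite add0r.
exact: dominatedD.
Qed.

Lemma dominated_anti f g : dominated f g -> dominated g f -> C (f, g).
Proof.
move=> fg gf; apply: (congruence_trans HC gf).
by rewrite addrC; apply: congruence_sym.
Qed.

(** Different terms of [s] may win at different points, since only their maximum has to lie above
    the monomial. *)
Lemma dominated_cover t (s : seq (R * (int * int))) f :
    (forall t', t' \in s -> dominated (mono t') f) ->
    (forall z, exists2 t', t' \in s & t.1 + dot t.2 z <= t'.1 + dot t'.2 z) ->
  dominated (mono t) f.
Proof.
move=> sf H; apply: (@dominated_trans (\sum_(t <- s) mono t)).
  apply: dominated_le => z; have [t' st' tt'] := H z.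
  rewrite -(mono_sum_ge z st') addrA; congr (_ + _).
  by rewrite !monoE; apply/tfin_le.
exact: dominated_sum.
Qed.

End Dominated.

End Trop.

(** * Cones of the fan of the line *)

Section Line.
Variable R : realType.
Implicit Types (f g : tlfun R) (m n p q : int * int) (z : R * R).

(* Coordinates of z along two of the three rays; t_1, t_2, t_3 refer to the
   rays in the order of the definition of the line. *)
Lemma line_cone z : exists t1 t2 t3 : R,
  [/\ 0 <= t1, 0 <= t2, 0 <= t3, [\/ t1 = 0, t2 = 0 | t3 = 0] &
      z = (t3 - t1, t3 - t2)].
Proof.
case: z => x y; pose t := Num.max 0 (Num.max x y).
exists (t - x), (t - y), t.
have [t0 tx ty] : [/\ 0 <= t, x <= t & y <= t] by rewrite !le_max !lexx !orbT.
split; rewrite ?subr_ge0 //; last by congr pair; lra.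
rewrite /t; case: (leP x y) => _; case: leP => _;
  by [apply: Or33|apply: Or31; rewrite subrr|apply: Or32; rewrite subrr].
Qed.

Lemma seq_argmax (I : eqType) (s : seq I) (F : I -> R) : s != [::] ->
  exists2 i, i \in s & forall j, j \in s -> F j <= F i.
Proof.
elim: s => // i s IH _; have [->|/IH[k ks ksm]] := eqVneq s [::].
  by exists i; rewrite ?mem_head // => j; rewrite inE => /eqP->.
have [ik|ki] := leP (F i) (F k).
  by exists k => [|j]; rewrite inE ?ks ?orbT // => /predU1P[->|/ksm].
exists i => [|j]; first by rewrite mem_head.
by rewrite inE => /predU1P[->|/ksm/le_trans->] //; apply: ltW.
Qed.

(** * Congruences containing the generators *)

Section Generated.
Variable C : set (tlfun R * tlfun R).
Hypothesis HC : congruence C.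

Lemma dominated_Delta (c : R) p q n f :
    let a := Num.min p.1 q.1 in let b := Num.min p.2 q.2 in
    let d := Num.max (p.1 + p.2) (q.1 + q.2) in
    dominated C (mono (c, (a, b))) f -> dominated C (mono (c, (a, d - a))) f ->
    dominated C (mono (c, (d - b, b))) f -> n \in Delta [fset p; q]%fset ->
  dominated C (mono (c, n)) f.
Proof.
move=> a b d fa fb fd; rewrite in_Delta2 => nD.
have [an bn nd] : [/\ a <= n.1, b <= n.2 & n.1 + n.2 <= d] by split; lia.
apply: (@dominated_cover _ _ HC _
  [:: (c, (a, b)); (c, (a, d - a)); (c, (d - b, b))]).
  by move=> t'; rewrite !inE => /or3P[] /eqP ->.
move: an bn nd; rewrite -!(ler_int R) => an bn nd z.
have [t1 [t2 [t3 [t1_ge0 t2_ge0 t3_ge0 t0 ->]]]] := line_cone z.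
have h1 := ler_wpM2r t1_ge0 an; have h2 := ler_wpM2r t2_ge0 bn.
have h3 := ler_wpM2r t3_ge0 nd.
(* On each cone, the chosen vertex maximises the slopes along both remaining rays. *)
case: t0 => t0;
  [exists (c, (d - b, b))|exists (c, (a, d - a))|exists (c, (a, b))];
  rewrite ?inE ?eqxx ?orbT //= /dot /=; move: h1 h2 h3;
  rewrite ?intrD ?intrN ?intrB t0; lra.
Qed.

Hypothesis SC : line_generators R `<=` C.

Lemma dominated_normal u v n : gcdz u v = 1 -> 0 < u \/ (u, v) = (0, 1) ->
    n \in Delta [fset (0, 0); (u, v)]%fset ->
  dominated C (mono (0, n)) (mono (0, (0, 0)) + mono (0, (u, v))).
Proof.
move=> uv1 uvn nD.
have e : C (fset_tlfun R [fset (0, 0); (u, v)]%fset,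
            fset_tlfun R (Delta [fset (0, 0); (u, v)]%fset)).
  by apply: SC; exists u, v.
rewrite -fset_tlfun2.
set f := fset_tlfun R _ in e *; set g := fset_tlfun R _ in e.
apply: (@dominated_trans _ _ HC g).
  by apply: dominated_le => // z; apply: fset_tlfun_ge.
by have := congruenceD HC (congruence_refl HC f) e; rewrite tlfunxx.
Qed.

(** The generators contain one of each pair of opposite primitive vectors; the other is handled by
    translating the triangle by it. *)
Lemma dominated_primitive m n : gcdz m.1 m.2 = 1 ->
    n \in Delta [fset (0, 0); m]%fset ->
  dominated C (mono (0, n)) (mono (0, (0, 0)) + mono (0, m)).
Proof.
case: m => u v /= uv1 nD.
have [uvn|uvn] : (0 < u \/ (u, v) = (0, 1)) \/ (0 < - u \/ (- u, - v) = (0, 1)).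
- case: (ltgtP u 0) => [u0|u0|u0]; [by right; left; lia|by left; left|].
  move: uv1; rewrite u0 gcd0z; case: v {nD} => [[|[|v]]|[|v]] //= _.
    by left; right.
  by right; right.
- exact: dominated_normal.
have nD' : n - (u, v) \in Delta [fset (0, 0); (- u, - v)]%fset.
  by move: nD; rewrite !in_Delta2 /=; lia.
have := dominated_normal _ uvn nD'; rewrite gcdNz gcdzN => /(_ uv1).
move=> /(dominated_shift HC (0, (u, v))); rewrite mulrDr !monoM /= !addr0.
by rewrite subrKC [(u, v) + (- u, - v)]subrr addrC.
Qed.

(* As functions, (0 (+) x^m)^k = 0 (+) x^(km). *)
Lemma dominated_multiple k m n : gcdz m.1 m.2 = 1 ->
    n \in Delta [fset (0, 0); m]%fset ->
  dominated C (mono (0, n *+ k)) (mono (0, (0, 0)) + mono (0, m *+ k)).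
Proof.
move=> m1 nD; have := dominatedX HC k (dominated_primitive m1 nD).
have monoX p : mono (0, p) ^+ k = mono (0, p *+ k) :> tlfun R.
  elim: k => [|k IH]; last by rewrite exprS IH monoM addr0 mulrS.
  by apply: tlfunP => z; rewrite monoE /dot /= !mul0r !addr0.
rewrite monoX => /(dominated_trans HC); apply; apply: dominated_le => // z.
rewrite tlfunXE !tlfunDE !monoE !add0r !dot0 dotX !tfinD tfinX.
apply/tfin_le; rewrite le_max; case: (leP 0 (dot m z)) => _.
  by rewrite lexx orbT.
by rewrite mul0rn lexx.
Qed.


(** For m = k m' with m' primitive, the vertices of the triangle are k times those for m', within
    reach of [dominated_multiple]. Other points need not be multiples of k, hence the use of
    [dominated_Delta]. *)
Lemma dominated_origin m n : n \in Delta [fset (0, 0); m]%fset ->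
  dominated C (mono (0, n)) (mono (0, (0, 0)) + mono (0, m)).
Proof.
have [->|/primitive_decomposition[k [[u v] [m1 ->]]]] := eqVneq m (0, 0).
  case: n => x y; rewrite in_Delta2 /= => n0.
  rewrite (_ : (x, y) = (0, 0)); last by congr pair; lia.
  by rewrite tlfunxx; apply: dominated_le => // z; apply: troppxx.
rewrite pairX => /(dominated_Delta (c := 0)); apply;
  rewrite /= ?addr0 -?mulrnDl ?min0X ?max0X -?mulrnBl -!pairX;
  by apply: dominated_multiple => //; rewrite in_Delta2 /=; lia.
Qed.

Lemma dominated_between (c : R) p q n f :
    n \in Delta [fset p; q]%fset ->
    dominated C (mono (c, p)) f -> dominated C (mono (c, q)) f ->
  dominated C (mono (c, n)) f.
Proof.
move=> nD pf qf; apply: (dominated_trans HC) (dominatedD HC pf qf).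
have /dominated_origin/(dominated_shift HC (c, p)) :
    n - p \in Delta [fset (0, 0); q - p]%fset.
  by move: nD; rewrite !in_Delta2 /=; lia.
by rewrite mulrDr !monoM /= !addr0 !subrKC.
Qed.

(* [sA], [sB], [sD] are, in some order, the slopes of a monomial along the three
   rays, and [mk] recovers the exponent from the first two.  Only the hypothesis
   on the ray of [sA] is needed to dominate the exponent [k], whose other slopes
   do not exceed those of the leading exponent [p]. *)
Lemma dominated_ray (sA sB sD : int * int -> int) (mk : int -> int -> int * int)
    (s : seq (R * (int * int))) (M c : R) p n k f :
    (forall n, sA n + sB n + sD n = 0) ->
    (forall a b, sA (mk a b) = a /\ sB (mk a b) = b) ->
    (forall n p q, (n \in Delta [fset p; q]%fset) =
      [&& (sA n <= sA p) || (sA n <= sA q), (sB n <= sB p) || (sB n <= sB q) &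
          (sD n <= sD p) || (sD n <= sD q)]) ->
    (forall z, exists t1 t2 t3 : R,
      [/\ 0 <= t1, 0 <= t2, 0 <= t3, [\/ t1 = 0, t2 = 0 | t3 = 0] &
      forall n, dot n z =
        (sA n)%:~R * t1 + (sB n)%:~R * t2 + (sD n)%:~R * t3]) ->
    (forall t, t \in s -> dominated C (mono t) f) ->
    (M, p) \in s -> (forall t, t \in s -> t.1 <= M) -> c <= M ->
    (forall x, 0 <= x -> exists2 t, t \in s &
      c + (sA n)%:~R * x <= t.1 + (sA t.2)%:~R * x) ->
    sA k = Num.max (sA n) (sA p) -> sB k = sB p ->
  dominated C (mono (c, k)) f.
Proof.
move=> s0 mkE DE cone sf ps sM cM ray kA kB.
have dec (c1 c2 : R) m : c1 <= c2 -> dominated C (mono (c2, m)) f ->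
    dominated C (mono (c1, m)) f.
  move=> c12; apply: dominated_trans => //; apply: dominated_le => // z.
  by rewrite !monoE; apply/tfin_le; rewrite lerD2r.
have mkD a b : sD (mk a b) = - a - b.
  by have := s0 (mk a b); case: (mkE a b) => -> ->; lia.
have mkA a b := (mkE a b).1; have mkB a b := (mkE a b).2.
have kD : sD k = - Num.max (sA n) (sA p) - sB p.
  by have := s0 k; rewrite kA kB; lia.
have [np|pn] := leP (sA n) (sA p).
  (* Here [k] has the three slopes of [p], hence lies in the degenerate triangle of [p]. *)
  have kp : k \in Delta [fset p; p]%fset.
    by move: kA kD; rewrite max_r // DE kB => -> ->; have := s0 p; lia.
  by have pf := dec _ _ _ cM (sf _ ps); apply: (dominated_between kp).
rewrite max_l ?(ltW pn) // in kA kD.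
(* Both exponents raise the slope along the ray of [sA] to at least that of [p]; [V1] keeps the
   slope [sB p], and [V2] keeps [sD p]. They lie in the triangle of [t.2] and [p]. *)
pose V1 (t : R * (int * int)) := (t.1, mk (Num.max (sA t.2) (sA p)) (sB p)).
pose V2 (t : R * (int * int)) :=
  (t.1, mk (Num.max (sA t.2) (sA p)) (- Num.max (sA t.2) (sA p) - sD p)).
have Vf t : t \in s ->
    dominated C (mono (V1 t)) f /\ dominated C (mono (V2 t)) f.
  move=> ts; have tM := sM t ts; case: t tM ts => a m /= am ts.
  have fp := dec _ _ _ am (sf _ ps).
  split; apply: (dominated_between _ (sf _ ts) fp);
    by rewrite DE mkA mkB mkD /=; have := s0 p; lia.
apply: (@dominated_cover _ _ HC _
  ((M, p) :: [seq V1 t | t <- s] ++ [seq V2 t | t <- s])).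
  move=> t; rewrite inE mem_cat.
  case/or3P=> [/eqP->|/mapP[t' /Vf[]]|/mapP[t' /Vf[]]];
    by [exact: sf|move=> ? ? ->].
have DkR : (sD k)%:~R <= (sD p)%:~R :> R by rewrite ler_int; have := s0 p; lia.
move=> z; have [t1 [t2 [t3 [t1_ge0 t2_ge0 t3_ge0 t0 zE]]]] := cone z.
have hD := ler_wpM2r t3_ge0 DkR.
have [t ts ht] := ray t1 t1_ge0.
have hm : ((sA t.2)%:~R : R) <= (Num.max (sA t.2) (sA p))%:~R.
  by rewrite ler_int le_max lexx.
have hA := ler_wpM2r t1_ge0 hm.
(* Each cone omits one ray: without that of [sA] the leading monomial suffices, without that of [sB]
   a [V2], without that of [sD] a [V1]. *)
case: t0 => t0.
- exists (M, p); rewrite ?mem_head // !zE /= kB t0; lra.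
- exists (V2 t); first by rewrite inE mem_cat map_f ?orbT.
  rewrite !zE /= t0 kA mkA mkD.
  rewrite (_ : - _ - (_ - _) = sD p); first lra.
  ring.
- exists (V1 t); first by rewrite inE mem_cat map_f ?orbT.
  rewrite !zE /= t0 kA kB mkA mkB; lra.
Qed.

Lemma mono_dominated t f :
    (forall z, tropical_line R z -> mono t z + f z = f z) ->
  dominated C (mono t) f.
Proof.
have [s fE] := tlfun_terms f; case: t => c n tf.
have sf t : t \in s -> dominated C (mono t) f.
  by move=> ts; apply: dominated_le => // z; rewrite fE; apply: mono_sum_ge.
have att z : tropical_line R z ->
    exists2 t', t' \in s & c + dot n z <= t'.1 + dot t'.2 z.
  by move/tf; rewrite fE => /mono_attained.
(* The origin lies on the line, and evaluation there compares coefficients. *)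
have [t0 t0s ct0] : exists2 t, t \in s & c <= t.1.
  have [|t ts] := att (0, 0); first by left; left; exists 0; rewrite /= ?mul0r.
  by rewrite /dot /= !mulr0 !addr0; exists t.
have [[M p] ps sM] : exists2 q : R * (int * int),
    q \in s & forall t, t \in s -> t.1 <= q.1.
  by apply: seq_argmax; apply: contraTneq t0s => ->.
have cM : c <= M := le_trans ct0 (sM _ t0s).
(* The exponents [k1], [k2], [k3] treat the three rays in turn: the slope along the treated ray is
   the larger of those of [n] and [p], one other slope is that of [p], and the slopes sum to
   zero. *)
pose k1 := (Num.min n.1 p.1, p.2).
have k1f : dominated C (mono (c, k1)) f.
  apply: (@dominated_ray (fun n => - n.1) (fun n => - n.2) (fun n => n.1 + n.2)
    (fun a b => (- a, - b)) s M c p n) => //=.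
  - move=> m; lia.
  - move=> a b; lia.
  - move=> m q r; rewrite in_Delta2; lia.
  - move=> z; have [t1 [t2 [t3 [t1_ge0 t2_ge0 t3_ge0 t_0 ->]]]] := line_cone z.
    by exists t1, t2, t3; split=> // m; rewrite /dot /= ?intrD ?intrN; ring.
  - move=> x x0; have [|t ts h] := att (- x, 0).
      by left; left; exists x => //=; congr pair; ring.
    by exists t => //; move: h; rewrite /dot /= ?intrN; lra.
  - lia.
pose k2 := (p.1, Num.min n.2 p.2).
have k2f : dominated C (mono (c, k2)) f.
  apply: (@dominated_ray (fun n => - n.2) (fun n => - n.1) (fun n => n.1 + n.2)
    (fun a b => (- b, - a)) s M c p n) => //=.
  - move=> m; lia.
  - move=> a b; lia.
  - move=> m q r; rewrite in_Delta2; lia.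
  - move=> z; have [t1 [t2 [t3 [t1_ge0 t2_ge0 t3_ge0 t_0 ->]]]] := line_cone z.
    exists t2, t1, t3; split=> // [|m]; last first.
      by rewrite /dot /= ?intrD ?intrN; ring.
    by case: t_0; [exact: Or32|exact: Or31|exact: Or33].
  - move=> x x0; have [|t ts h] := att (0, - x).
      by left; right; exists x => //=; congr pair; ring.
    by exists t => //; move: h; rewrite /dot /= ?intrN; lra.
  - lia.
pose k3 := (Num.max (n.1 + n.2) (p.1 + p.2) - p.2, p.2).
have k3f : dominated C (mono (c, k3)) f.
  apply: (@dominated_ray (fun n => n.1 + n.2) (fun n => - n.2) (fun n => - n.1)
    (fun a b => (a + b, - b)) s M c p n) => //=.
  - move=> m; lia.
  - move=> a b; lia.
  - move=> m q r; rewrite in_Delta2; lia.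
  - move=> z; have [t1 [t2 [t3 [t1_ge0 t2_ge0 t3_ge0 t_0 ->]]]] := line_cone z.
    exists t3, t2, t1; split=> // [|m]; last first.
      by rewrite /dot /= ?intrD ?intrN; ring.
    by case: t_0; [exact: Or33|exact: Or32|exact: Or31].
  - move=> x x0; have [|t ts h] := att (x, x).
      by right; exists x => //=; congr pair; ring.
    by exists t => //; move: h; rewrite /dot /= ?intrD; lra.
  - lia.
(* In each case two of these exponents are chosen so that every inequality of the triangle holds for
   [n] against one of them. *)
have [n1|n1] := leP n.1 p.1; last first.
  apply: (dominated_between _ k2f k3f).
  by rewrite in_Delta2 /k2 /k3 /=; lia.
have [n2|n2] := leP n.2 p.2.
  apply: (dominated_between _ k1f k2f).
  by rewrite in_Delta2 /k1 /k2 /=; lia.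
apply: (dominated_between _ k1f k3f).
by rewrite in_Delta2 /k1 /k3 /=; lia.
Qed.

Lemma tropical_line_dominated f g :
  (forall z, tropical_line R z -> f z + g z = g z) -> dominated C f g.
Proof.
have [s ->] := tlfun_terms f => fg.
apply: dominated_sum => // t ts; apply: mono_dominated => z /fg <-.
by rewrite addrA mono_sum_ge.
Qed.

Lemma congruence_of_sub_generated : congruence_of (tropical_line R) `<=` C.
Proof.
case=> f g /= fg; apply: (dominated_anti HC);
  by apply: tropical_line_dominated => z /fg; rewrite /= => ->; apply: troppxx.
Qed.

End Generated.

(** * Agreement of the generators on the line *)

Lemma congruence_congruence_of (Z : set (R * R)) : congruence (congruence_of Z).
Proof.
split=> /=.
- by [].
- by move=> f g fg z /fg.
- by move=> f g h fg gh z Zz; rewrite fg ?gh.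
- by move=> f g f' g' fg fg' z Zz; rewrite !tlfunDE fg ?fg'.
- by move=> f g f' g' fg fg' z Zz; rewrite !tlfunME fg ?fg'.
Qed.

Lemma line_generators_sub :
  line_generators R `<=` congruence_of (tropical_line R).
Proof.
move=> _ [u [v [_ _ ->]]] z Lz; set A := [fset _; _]%fset.
rewrite -[LHS]/(fset_tlfun R A z) -[RHS]/(fset_tlfun R (Delta A) z).
have uvA : (0, 0) \in A /\ (u, v) \in A by rewrite !inE !eqxx orbT.
apply: trop_anti.
  rewrite {1}fset_tlfun_terms sumE; apply: sum_le => m mA.
  apply: fset_tlfun_ge; move: mA; rewrite in_Delta2 !inE.
  by case/orP=> /eqP -> /=; lia.
rewrite {1}fset_tlfun_terms sumE; apply: sum_le => m.
rewrite in_Delta2 => /and3P[h1 h2 h3].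
(* On a ray only one slope counts, and the matching inequality of the triangle bounds it by that of
   [(0, 0)] or of [(u, v)]. *)
have [q qA mq] : exists2 q, q \in A & dot m z <= dot q z.
  suff [?|?] : dot m z <= dot (0, 0) z \/ dot m z <= dot (u, v) z.
  - by exists (0, 0) => //; case: uvA.
  - by exists (u, v) => //; case: uvA.
  move: h1 h2 h3; rewrite /dot /= => h1 h2 h3.
  case: Lz => [[]|] [t /= t0 <-] /=.
  - by case/orP: h1; rewrite -(ler_int R) => /(ler_wpM2r t0); [left|right]; lra.
  - by case/orP: h2; rewrite -(ler_int R) => /(ler_wpM2r t0); [left|right]; lra.
  - case/orP: h3; rewrite -(ler_int R) !intrD => /(ler_wpM2r t0);
      by [left; lra|right; lra].
rewrite -(fset_tlfun_ge z qA) addrA; congr (_ + _).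
by rewrite !monoE !add0r; apply/tfin_le.
Qed.

End Line.

(** * Minimality through widths of Newton polygons *)

Section Minimality.
Variable R : realType.
Implicit Types (f g : tlfun R) (m n p q : int * int) (w z : R * R).

(* The Newton polygon of f has width 0 in the direction [w]: by convexity,
   t |-> f(t w) + f(- t w) grows like |t| times this width. *)
Definition flat w f := exists B : R, forall x : R,
  f (x * w.1, x * w.2) * f (- x * w.1, - x * w.2) + tfin B = tfin B.

Lemma flat0 w : flat w 0.
Proof. by exists 0. Qed.

Hint Resolve flat0 : core.

(** The product of the two values of [f] is a term of the expanded product of those of [f + g]. *)
Lemma flatDl w f g : flat w (f + g) -> flat w f.
Proof.
case=> B fgB; exists B => x; rewrite -[in RHS](fgB x) -[in LHS](fgB x) !tlfunDE.
by rewrite addrA; congr (_ + _); rewrite mulrDl !mulrDr !addrA troppxx.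
Qed.

Lemma flatDr w f g : flat w (f + g) -> flat w g.
Proof. by rewrite addrC; apply: flatDl. Qed.

(** Any term of a nonzero function is a finite lower bound for it, which allows cancellation in
    [flatMl]. *)
Lemma tlfun_neq0 g : g <> 0 -> exists t : R * (int * int), forall z,
  exists2 r : R, g z = tfin r & t.1 + dot t.2 z <= r.
Proof.
have [[|t s] ->] := tlfun_terms g; first by rewrite big_nil.
move=> _; exists t => z; rewrite big_cons tlfunDE monoE.
case: ((\sum_(i <- s) mono i) z) => [r|]; last by exists (t.1 + dot t.2 z).
by exists (Num.max (t.1 + dot t.2 z) r); rewrite ?tfinD // le_max lexx.
Qed.

Lemma flatMl w f g : flat w (f * g) -> g <> 0 -> flat w f.
Proof.
(* At opposite points the linear parts of the lower bound cancel, leaving twice its coefficient. *)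
move=> [B fgB] /tlfun_neq0[t gt]; exists (B - t.1 - t.1) => x.
have := fgB x; rewrite !tlfunME.
have [r -> rt] := gt (x * w.1, x * w.2).
have [r' -> rt'] := gt (- x * w.1, - x * w.2).
move: rt rt'; rewrite !dotZ.
case: (f _) => [a|] //; case: (f _) => [b|] // rt rt'.
rewrite -/(tfin a) -/(tfin b) !tfinM => /tfin_le h.
by apply/tfin_le; lra.
Qed.

Lemma flatMr w f g : flat w (f * g) -> f <> 0 -> flat w g.
Proof. by rewrite mulrC; apply: flatMl. Qed.

Lemma flat_mono2 w p q :
  flat w (mono (0, p) + mono (0, q)) -> dot p w = dot q w.
Proof.
suff key m n : flat w (mono (0, m) + mono (0, n)) -> dot n w <= dot m w.
  move=> pq; apply/le_anti; rewrite (key p q) // andbT.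
  by apply: (key q p); rewrite [mono _ + _]addrC.
case=> B H; rewrite leNgt; apply/negP; rewrite -subr_gt0 => mn.
(* At this multiple of [w] the two monomials differ by [|B| + 1], which exceeds the bound [B]. *)
have := H ((`|B| + 1) / (dot n w - dot m w)).
rewrite !mono2E !dotZ tfinM => /tfin_le.
set x := _ / _; rewrite leNgt => /negP; apply.
have xE : x * (dot n w - dot m w) = `|B| + 1 by rewrite /x divfK // gt_eqF.
have hB := ler_norm B.
apply: (@lt_le_trans _ _ (x * dot n w + - x * dot m w)); first by lra.
by apply: lerD; rewrite le_max lexx ?orbT.
Qed.

Definition flat_congruence w : set (tlfun R * tlfun R) :=
  [set fg | fg.1 = fg.2 \/
     [/\ congruence_of (tropical_line R) fg, ~ flat w fg.1 & ~ flat w fg.2]].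

Lemma congruence_flat w : congruence (flat_congruence w).
Proof.
have HL := @congruence_congruence_of R (tropical_line R).
have neq0 f : ~ flat w f -> f <> 0 by move=> nf f0; apply/nf; rewrite f0.
split; rewrite /flat_congruence /=.
- by move=> f; left.
- move=> f g [->|[fg nf ng]]; first by left.
  by right; split=> //; apply: (congruence_sym HL).
- move=> f g h [->|[fg nf ng]] // [<-|[gh _ nh]]; first by right.
  by right; split=> //; apply: (congruence_trans HL fg gh).
- move=> f g f' g' [<-|[fg nf ng]] [<-|[fg' nf' ng']]; first by left.
  + right; split; try by move=> /flatDr.
    exact: (congruenceD HL (congruence_refl HL _) fg').
  + right; split; try by move=> /flatDl.
    exact: (congruenceD HL fg (congruence_refl HL _)).
  + right; split; try by move=> /flatDl.
    exact: (congruenceD HL fg fg').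
- move=> f g f' g' [<-|[fg nf ng]] [<-|[fg' nf' ng']]; first by left.
  (* A zero factor destroys positive width, but then both products are zero and the equality clause
     applies. *)
  + have [->|f0] := pselect (f = 0); first by left; rewrite !mul0r.
    right; split; try by move=> /flatMr/(_ f0).
    exact: (congruenceM HL (congruence_refl HL _) fg').
  + have [->|f0] := pselect (f' = 0); first by left; rewrite !mulr0.
    right; split; try by move=> /flatMl/(_ f0).
    exact: (congruenceM HL fg (congruence_refl HL _)).
  + right; split; try by move=> /flatMl h; auto.
    exact: (congruenceM HL fg fg').
Qed.

(** The function absorbs the monomials of [p] and [q], so its flatness passes to their sum. *)
Lemma flat_fset w (A : {fset int * int}) p q : p \in A -> q \in A ->
  flat w (fset_tlfun R A) -> dot p w = dot q w.
Proof.
move=> pA qA fA; apply: flat_mono2.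
apply: (@flatDl w _ (fset_tlfun R A)); rewrite (_ : _ + _ = fset_tlfun R A) //.
by apply: tlfunP => z; rewrite !tlfunDE -addrA !fset_tlfun_ge.
Qed.

Lemma line_generators_minimal (B : set (tlfun R * tlfun R)) :
  B `<` line_generators R -> ~ generates B (congruence_of (tropical_line R)).
Proof.
move=> [BS SB] [_ _ gen].
have [_ [u [v [uv1 uvn ->]]] s0B] : exists2 s, line_generators R s & ~ B s.
  apply: contrapT => H; apply: SB => s Ss.
  by apply: contrapT => Bs; apply: H; exists s.
pose w : R * R := (- v%:~R, u%:~R).
have wE n : dot n w = (n.2 * u - n.1 * v)%:~R.
  by rewrite /dot /= intrB !intrM; ring.
have sub : B `<=` flat_congruence w.
  move=> b bB; have [u' [v' [uv1' uvn' bE]]] := BS b bB.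
  have nflat (A : {fset int * int}) : (0, 0) \in A -> (u', v') \in A ->
      ~ flat w (fset_tlfun R A).
    (* Zero width would make [(u', v')] proportional, hence equal, to [(u, v)], and [b] would be the
       omitted generator. *)
    move=> A0 A1 /(flat_fset A0 A1); rewrite !wE => /intr_inj e.
    apply: s0B; rewrite (@proportional_eq u v u' v') // -?bE //.
    by move: e => /=; lia.
  right; rewrite bE; split => /=.
  - by rewrite -bE; apply/line_generators_sub/BS.
  - by apply: nflat; rewrite !inE eqxx ?orbT.
  - by apply: nflat; rewrite in_Delta2 /=; lia.
have /(gen _ (congruence_flat w) sub) : congruence_of (tropical_line R)
    (fset_tlfun R [fset (0, 0); (u, v)]%fset,
     fset_tlfun R (Delta [fset (0, 0); (u, v)]%fset)).
  by apply: line_generators_sub; exists u, v.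
have flat2 : flat w (fset_tlfun R [fset (0, 0); (u, v)]%fset).
  have wm : dot (u, v) w = 0 by rewrite wE /= mulrC subrr.
  exists 0 => x; rewrite fset_tlfun2 !mono2E !dotZ dot0 wm !mulr0 !maxxx.
  by rewrite tfinM addr0 tfinD maxxx.
(* Only the equality clause is possible, so the triangle would be flat too. Two of its points refute
   this: for u > 0 the ends of its edge on the line x = 0, otherwise [(0, 0)] and [(1, 0)]. *)
case=> [/= fE|[_ /(_ flat2)]] //; rewrite fE in flat2.
case: uvn => [u0|[uE vE]].
  have := flat_fset (p := (0, Num.min 0 v)) (q := (0, Num.max 0 (u + v)))
    _ _ flat2.
  rewrite !in_Delta2 !wE /= => H.
  by have /intr_inj := H ltac:(lia) ltac:(lia); nia.
have := flat_fset (p := (0, 0)) (q := (1, 0)) _ _ flat2.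
rewrite !in_Delta2 !wE /= => H.
by have /intr_inj := H ltac:(lia) ltac:(lia); lia.
Qed.

End Minimality.

Theorem theorem1p3 (R : realType) :
  minimal_generating_set (line_generators R)
    (congruence_of (tropical_line R)).
Proof.
split; last exact: line_generators_minimal.
split; first exact: congruence_congruence_of.
  exact: line_generators_sub.
exact: congruence_of_sub_generated.
Qed.
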